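(* The function $\psi:\mathbb{R}^2\to\mathbb{R}$ defined by $$\psi(s,t)=\begin{cases}\dfrac{s^2}{2}+\dfrac{(-t)_+^2}{2}&\text{if } s\le t,\\[2mm] \dfrac{t^2}{2}+\dfrac{(-s)_+^2}{2}&\text{if } s>t\end{cases}\;=\;\frac{\min(s,t)^2}{2}+\frac{\max(-\max(s,t),0)^2}{2}$$ is a nonnegative $C$-function. Moreover, $\psi$ is differentiable on $K_1\cup K_2$, where $K_1:=\{(a,b)\in\mathbb{R}^2: a>b\text{ or }a=b\le 0\}$ and $K_2:=\{(a,b)\in\mathbb{R}^2: a<b\text{ or }a=b\le 0\}$, and its $B$-subdifferential is $$\partial_B\psi(s,t)=\begin{cases}\{(s,-(-t)_+)\}&\text{if } s<t\text{ or }s=t\le 0,\\ \{(-(-s)_+,t)\}&\text{if } s>t,\\ \{(s,0),(0,t)\}&\text{if } s=t>0.\end{cases}$$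
   Context: $x_+:=\max(0,x)$. A function $\phi:\mathbb{R}^2\to\mathbb{R}$ is a $C$-function (complementarity function) if $\phi(s,t)=0\iff s\ge 0,\ t\ge 0,\ st=0$. For a locally Lipschitz function $F:\mathbb{R}^d\to\mathbb{R}$, the $B$-subdifferential at $x$ is $\partial_BF(x):=\{\lim_{k\to\infty}\nabla F(x^k): x^k\to x,\ F\text{ differentiable at each }x^k\}$. *)

(* Defs.v *)
From HB Require Import structures.
From mathcomp Require Import all_boot all_order all_algebra.
From mathcomp Require Import all_classical all_reals all_analysis.
Import Order.TTheory GRing.Theory Num.Theory.
Import numFieldNormedType.Exports.
Set Implicit Arguments.
Unset Strict Implicit.
Unset Printing Implicit Defensive.

Local Open Scope classical_set_scope.
Local Open Scope ring_scope.

(* R^d is 'rV[R]_d: its norm is the sup norm, which induces the same topology,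
   derivatives and locally Lipschitz functions as the Euclidean one. *)

Definition vec2 (R : realType) (s t : R) : 'rV[R]_2 :=
  \row_(i < 2) [:: s; t]`_i.

Definition pospart (R : realType) (x : R) : R := Num.max 0 x.

Definition C_function (R : realType) (phi : 'rV[R]_2 -> R) : Prop :=
  forall s t : R, phi (vec2 s t) = 0 <-> [/\ 0 <= s, 0 <= t & s * t = 0].

Definition locally_lipschitz (R : realType) (d : nat) (F : 'rV[R]_d -> R)
    : Prop :=
  forall x : 'rV[R]_d,
    exists2 U : set 'rV[R]_d, nbhs x U & [lipschitz F y | y in U].

Definition gradient (R : realType) (d : nat) (F : 'rV[R]_d -> R)
    (x : 'rV[R]_d) : 'rV[R]_d :=
  \row_(i < d) 'D_(delta_mx 0 i) F x.

(* Only meaningful for locally Lipschitz F. *)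
Definition B_subdifferential (R : realType) (d : nat) (F : 'rV[R]_d -> R)
    (x : 'rV[R]_d) : set 'rV[R]_d :=
  [set g | exists u : nat -> 'rV[R]_d,
      [/\ u k @[k --> \oo] --> x,
          forall k : nat, differentiable F (u k)
        & gradient F (u k) @[k --> \oo] --> g]].

Definition psi (R : realType) (x : 'rV[R]_2) : R :=
  let s := x 0 0 in
  let t := x 0 1 in
  if s <= t then s ^+ 2 / 2 + pospart (- t) ^+ 2 / 2
  else t ^+ 2 / 2 + pospart (- s) ^+ 2 / 2.

Definition K1 (R : realType) : set 'rV[R]_2 :=
  [set x | x 0 0 > x 0 1 \/ (x 0 0 = x 0 1 /\ x 0 1 <= 0)].

Definition K2 (R : realType) : set 'rV[R]_2 :=
  [set x | x 0 0 < x 0 1 \/ (x 0 0 = x 0 1 /\ x 0 1 <= 0)].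

(* Main.v *)
Require Import Defs.
From HB Require Import structures.
From mathcomp Require Import all_boot all_order all_algebra.
From mathcomp Require Import all_classical all_reals all_analysis.
From mathcomp Require Import lra.
Set Implicit Arguments.
Unset Strict Implicit.
Unset Printing Implicit Defensive.
Import Order.TTheory GRing.Theory Num.Theory.
Import numFieldNormedType.Exports.
Local Open Scope classical_set_scope.
Local Open Scope ring_scope.

(** The point is that [psi] is the minimum of two functions of class C^1,
    [x |-> (x 0 0) ^+ 2 / 2 + pospart (- x 0 1) ^+ 2 / 2] and the one with the
    coordinates exchanged ([psi_min]): their difference is half of
    [pospart (x 0 0) ^+ 2 - pospart (x 0 1) ^+ 2], so the first is at most the
    second if [x 0 0 <= x 0 1] and at least the second otherwise, and the
    definition of [psi] always selects a smallest one.

    Each piece is convex and lies below its tangent plane plus a quadratic term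
    ([piece_tangent]).  Two facts follow, which replace all explicit
    differentiation.

    A function that near [x] is always equal to one of the pieces, where the
    pieces used agree at [x] with their gradients, is differentiable at [x]
    ([differentiable_selection]).  Off the diagonal only one piece is used, and
    at [s = t <= 0] both pieces have value [s ^+ 2] and gradient [(s, t)]; this
    gives differentiability on [K1] and [K2].

    If [psi] is differentiable at [x] and equal there to a piece, its gradient
    is that of the piece, because [psi] touches the piece from below
    ([touching_piece_gradient]).  So at every differentiability point the
    gradient of [psi] is one of two continuous vector fields, and a limit of
    such gradients is a value of one of these fields
    ([B_subdifferential_branch]); off the diagonal only one of the fields occurs
    nearby.  Conversely, if [s <= t], then [(s, t)] is a limit of points of the
    open half-plane where the first piece is active, so that the gradient of
    that piece belongs to the B-subdifferential, and symmetrically if [t <= s].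
    On the diagonal both gradients belong to it: they coincide if [s <= 0], and
    are [(s, 0)] and [(0, t)] if [s > 0]. *)

(** * Differentiability from quadratic bounds *)

Lemma normr_entry_le (R : realType) (d : nat) (v : 'rV[R]_d) (i : 'I_d) :
  `|v 0 i| <= `|v|.
Proof.
rewrite [leRHS]/Num.norm /= mx_normrE.
exact: (le_bigmax (0 : R) (fun ij : 'I_1 * 'I_d => `|v ij.1 ij.2|) (0, i)).
Qed.

Definition dot (R : realType) (d : nat) (g v : 'rV[R]_d) : R :=
  \sum_(i < d) g 0 i * v 0 i.

Lemma dot_is_linear (R : realType) (d : nat) (g : 'rV[R]_d) :
  linear (dot g : 'rV[R]_d -> R^o).
Proof.
move=> a u v; rewrite /dot scaler_sumr -big_split /=.
by apply: eq_bigr => i _; rewrite !mxE mulrDr mulrCA.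
Qed.

HB.instance Definition _ (R : realType) (d : nat) (g : 'rV[R]_d) :=
  GRing.isLinear.Build R 'rV[R]_d R^o _ (dot g) (dot_is_linear g).

Lemma dot_continuous (R : realType) (d : nat) (g : 'rV[R]_d) :
  continuous (dot g).
Proof.
apply: (@continuous_big R 'I_d +%R) => [|i _ x].
  exact: (@add_continuous R^o).
have xi : y 0 i @[y --> x] --> x 0 i by exact: coord_continuous.
exact: cvgM (cvg_cst (g 0 i)) xi.
Qed.

Lemma dot_delta (R : realType) (d : nat) (g : 'rV[R]_d) (i : 'I_d) :
  dot g (delta_mx 0 i) = g 0 i.
Proof.
rewrite /dot (bigD1 i) //= mxE !eqxx mulr1 big1 ?addr0 // => j ji.
by rewrite mxE (negbTE ji) andbF mulr0.
Qed.

(** A first-order expansion with a quadratic error is one with an [o] error, so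
    no calculus rule is needed to differentiate the functions below. *)
Lemma quadratic_differentiable (R : realType) (d : nat) (F : 'rV[R]_d -> R)
    (x g : 'rV[R]_d) :
  (\forall y \near x, `|F y - F x - dot g (y - x)| <= `|y - x| ^+ 2) ->
  differentiable F x.
Proof.
move=> Fx; apply/diffP => /=.
(* The differential is chosen among the continuous linear maps that satisfy the
   expansion, so it suffices to exhibit one. *)
apply: (@getPex _ (fun df : {linear 'rV[R]_d -> R^o} => continuous df /\
  forall y, F y = F (lim (nbhs x)) + df (y - lim (nbhs x))
                  +o_(y \near x) (y - lim (nbhs x)))).
exists (dot g : {linear 'rV[R]_d -> R^o}); split; first exact: dot_continuous.
have lx : lim (nbhs x) = x by apply: lim_id.
suff : F = (fun y => F x + dot g (y - x)) +o_x (fun y => y - x).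
  by rewrite lx funeqE => H y; exact: H.
apply/eqaddoP => e e0.
have xe : \forall y \near x, `|y - x| <= e.
  apply/nbhs_ballP; exists e => //= y; rewrite -ball_normE /= distrC.
  exact: ltW.
apply: filterS2 Fx xe => y Fy ye /=.
rewrite -[X in `|X|]/(F y - (F x + dot g (y - x))) opprD addrA.
by rewrite (le_trans Fy) // expr2 ler_wpM2r.
Qed.

(** Touching from above: [F] only has to lie below a parabola that it meets at
    [x].  Along a direction [v] this bounds the right difference quotient, so
    ['D_v F x <= dot g v]; as the differential is linear, the same bound for
    [- v] is the reverse inequality. *)
Lemma upper_tangent_gradient (R : realType) (d : nat) (F : 'rV[R]_d -> R)
    (x g : 'rV[R]_d) :
  differentiable F x ->
  (forall y, F y <= F x + dot g (y - x) + `|y - x| ^+ 2) ->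
  gradient F x = g.
Proof.
move=> dF Fle.
have le v : 'D_v F x <= dot g v.
  have quot : h^-1 *: (F (h *: v + x) - F x) @[h --> 0^'+] --> 'D_v F x.
    have /cvg_ex[l hl] := @diff_derivable _ _ _ F x v dF.
    rewrite /derive (cvg_lim _ hl) //.
    exact: cvg_dnbhs_at_right hl.
  have h0 : h @[h --> 0^'+] --> (0 : R).
    by apply: cvg_at_right_filter; exact: cvg_id.
  have bound : dot g v + h * `|v| ^+ 2 @[h --> 0^'+] --> dot g v + 0 * `|v| ^+ 2.
    exact: cvgD (cvg_cst _) (cvgM h0 (cvg_cst _)).
  rewrite -[leRHS]addr0 -(mul0r (`|v| ^+ 2)).
  apply: ler_cvg_to quot bound _.
  near=> h.
  have h_gt0 : 0 < h by near: h; exact: nbhs_right_gt.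
  rewrite -[_ *: _]/(h^-1 * _) ler_pdivrMl // lerBlDl (le_trans (Fle _)) //.
  rewrite addrK linearZ /= normrZ gtr0_norm //.
  rewrite -addrA lerD2l mulrDr lerD2l exprMn expr2 -mulrA; exact: lexx.
apply/rowP => i; rewrite mxE -(dot_delta g i); apply/eqP; rewrite eq_le le /=.
have := le (- delta_mx 0 i).
by rewrite !deriveE // !linearN lerN2.
Unshelve. all: by end_near. Qed.

(** * Computing a B-subdifferential from a selection of gradients *)

Lemma B_subdifferential_approx (R : realType) (d : nat) (F : 'rV[R]_d -> R)
    (G : 'rV[R]_d -> 'rV[R]_d) (x : 'rV[R]_d) (u : nat -> 'rV[R]_d) :
  {for x, continuous G} -> u k @[k --> \oo] --> x ->
  (forall k, differentiable F (u k)) ->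
  (forall k, gradient F (u k) = G (u k)) ->
  B_subdifferential F x (G x).
Proof.
move=> Gx ux dF FG; exists u; split => //.
by under eq_cvg do rewrite FG; apply: cvg_comp ux Gx.
Qed.

(** No subsequence is extracted to find a branch that occurs infinitely often:
    the product of the distances from the gradient to the two candidates is
    eventually zero along the sequence, hence zero in the limit. *)
Lemma B_subdifferential_branch (R : realType) (d : nat) (F : 'rV[R]_d -> R)
    (G H : 'rV[R]_d -> 'rV[R]_d) (x g : 'rV[R]_d) :
  {for x, continuous G} -> {for x, continuous H} ->
  (\forall y \near x, differentiable F y ->
     gradient F y = G y \/ gradient F y = H y) ->
  B_subdifferential F x g -> g = G x \/ g = H x.
Proof.
move=> Gx Hx FGH [u [ux dF Fu]].
have distG : `|gradient F (u k) - G (u k)| @[k --> \oo] --> `|g - G x|.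
  exact: cvg_norm (cvgB Fu (cvg_comp _ _ ux Gx)).
have distH : `|gradient F (u k) - H (u k)| @[k --> \oo] --> `|g - H x|.
  exact: cvg_norm (cvgB Fu (cvg_comp _ _ ux Hx)).
have prod0 : `|gradient F (u k) - G (u k)| * `|gradient F (u k) - H (u k)|
    @[k --> \oo] --> (0 : R).
  have branch : \forall k \near \oo, differentiable F (u k) ->
    gradient F (u k) = G (u k) \/ gradient F (u k) = H (u k) := ux _ FGH.
  apply: cvg_near_cst; apply: filterS branch => k /(_ (dF k)).
  by case=> ->; rewrite subrr normr0 ?mul0r ?mulr0.
have /eqP : `|g - G x| * `|g - H x| = 0.
  apply: cvg_unique (cvgM distG distH) prod0; exact: norm_hausdorff.
by rewrite mulf_eq0 !normr_eq0 !subr_eq0 => /orP[] /eqP; [left | right].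
Qed.

Lemma near_entry_lt (R : realType) (d : nat) (x : 'rV[R]_d) (i j : 'I_d) :
  x 0 i < x 0 j -> \forall y \near x, (y : 'rV[R]_d) 0 i < y 0 j.
Proof.
move=> xij.
have coord k : {for x, continuous (fun y : 'rV[R]_d => y 0 k)}.
  exact: coord_continuous.
have := continuousB (coord j) (coord i).
move=> /cvgr_gt/(_ 0); rewrite /= subr_gt0 => /(_ xij).
by apply: filterS => y; rewrite /= subr_gt0.
Qed.

(** * The two smooth pieces *)

Variant pospart_spec (R : realType) (a : R) : R -> Prop :=
| PospartPos of 0 <= a : pospart_spec a a
| PospartNeg of a <= 0 : pospart_spec a 0.

Lemma pospartP (R : realType) (a : R) : pospart_spec a (pospart a).
Proof.
rewrite /pospart; case: (leP 0 a) => a0; first exact: PospartPos.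
by apply: PospartNeg; exact: ltW.
Qed.

Lemma pospartN_opp (R : realType) (a : R) : a <= 0 -> - pospart (- a) = a.
Proof. by case: pospartP => Ha a0; lra. Qed.

Lemma pospartN0 (R : realType) (a : R) : 0 < a -> pospart (- a) = 0.
Proof. by case: pospartP => Ha a0; lra. Qed.

Lemma pospart_lipschitz (R : realType) (a b : R) :
  `|pospart a - pospart b| <= `|a - b|.
Proof.
have := ler_norm (a - b); have := ler_norm (b - a); rewrite (distrC b).
by case: (pospartP a); case: (pospartP b) => *; rewrite ler_norml; lra.
Qed.

Lemma pospart_continuous (R : realType) : continuous (@pospart R).
Proof.
move=> a; apply: continuous_max; [exact: cvg_cst | exact: cvg_id].
Qed.

Definition half_sq_neg (R : realType) (a : R) : R := pospart (- a) ^+ 2 / 2.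

(** [half_sq_neg] is convex and its derivative [a |-> - pospart (- a)] is
    1-Lipschitz; hence the lower and the upper bound. *)
Lemma half_sq_neg_tangent (R : realType) (a b : R) :
  half_sq_neg a - pospart (- a) * (b - a) <= half_sq_neg b
  <= half_sq_neg a - pospart (- a) * (b - a) + (b - a) ^+ 2 / 2.
Proof.
rewrite /half_sq_neg.
have := sqr_ge0 a; have := sqr_ge0 b; have := sqr_ge0 (b - a).
case: (pospartP (- a)) => Ha; case: (pospartP (- b)) => Hb.
- by move=> *; apply/andP; split; lra.
- have ab : 0 <= (- a) * b by rewrite mulr_ge0 // -oppr_le0.
  by move=> *; apply/andP; split; lra.
- have ab : 0 <= a * (- b) by rewrite mulr_ge0 // -oppr_le0.
  by move=> *; apply/andP; split; lra.
- by move=> *; apply/andP; split; lra.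
Qed.

Lemma half_sq_tangent (R : realType) (a b : R) :
  b ^+ 2 / 2 = a ^+ 2 / 2 + a * (b - a) + (b - a) ^+ 2 / 2.
Proof. lra. Qed.

(** [piece 0 1] and [piece 1 0] are the two formulas that define [psi];
    the index pair lets one proof serve both. *)
Definition piece (R : realType) (i j : 'I_2) (x : 'rV[R]_2) : R :=
  x 0 i ^+ 2 / 2 + half_sq_neg (x 0 j).

Definition piece_gradient (R : realType) (i j : 'I_2) (x : 'rV[R]_2) :
    'rV[R]_2 :=
  x 0 i *: delta_mx 0 i - pospart (- x 0 j) *: delta_mx 0 j.

Lemma dot_piece_gradient (R : realType) (i j : 'I_2) (x v : 'rV[R]_2) :
  dot (piece_gradient i j x) v = x 0 i * v 0 i - pospart (- x 0 j) * v 0 j.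
Proof.
have dotC (f g : 'rV[R]_2) : dot f g = dot g f.
  by apply: eq_bigr => k _; rewrite mulrC.
by rewrite dotC linearB !linearZ /= !dot_delta.
Qed.

(** The lower bound (convexity) and the upper bound (Lipschitz gradient) play
    different roles: the upper one makes [piece i j] a parabola-like barrier for
    functions below it, the two together make it differentiable.  Each of the
    two coordinates contributes an error of at most half of [`|y - x| ^+ 2],
    because the norm is the sup norm. *)
Lemma piece_tangent (R : realType) (i j : 'I_2) (x y : 'rV[R]_2) :
  0 <= piece i j y - piece i j x - dot (piece_gradient i j x) (y - x)
    <= `|y - x| ^+ 2.
Proof.
rewrite dot_piece_gradient.
have sq_le k : (y - x) 0 k ^+ 2 <= `|y - x| ^+ 2.
  by rewrite -real_normK ?num_real // lerXn2r ?nnegrE // normr_entry_le.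
have := sq_le i; have := sq_le j; rewrite !mxE => vj vi.
have /andP[lo hi] := half_sq_neg_tangent (x 0 j) (y 0 j).
rewrite /piece (half_sq_tangent (x 0 i) (y 0 i)).
have := sqr_ge0 (y 0 i - x 0 i).
move: vi vj lo hi; lra.
Qed.

Lemma piece_gradient_continuous (R : realType) (i j : 'I_2) :
  continuous (@piece_gradient R i j).
Proof.
move=> x.
have coord k : {for x, continuous (fun y : 'rV[R]_2 => y 0 k)}.
  exact: coord_continuous.
have neg_coord : {for x, continuous (fun y : 'rV[R]_2 => pospart (- y 0 j))}.
  exact: continuous_comp (continuousN (coord j)) (@pospart_continuous R _).
exact: cvgB (cvgZ (coord i) (cvg_cst _)) (cvgZ neg_coord (cvg_cst _)).
Qed.

Lemma piece_lipschitz_on_ball (R : realType) (i j : 'I_2) (M : R)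
    (y z : 'rV[R]_2) :
  `|y| <= M -> `|z| <= M -> `|piece i j y - piece i j z| <= 2 * M * `|y - z|.
Proof.
move=> yM zM.
have dk k : `|y 0 k - z 0 k| <= `|y - z|.
  by have := normr_entry_le (y - z) k; rewrite !mxE.
have yk k := le_trans (normr_entry_le y k) yM.
have zk k := le_trans (normr_entry_le z k) zM.
have M0 : 0 <= M by rewrite (le_trans _ yM).
have sq_lip a b : `|a| <= M -> `|b| <= M ->
    `|a ^+ 2 / 2 - b ^+ 2 / 2| <= M * `|a - b|.
  move=> aM bM.
  have -> : a ^+ 2 / 2 - b ^+ 2 / 2 = (a + b) / 2 * (a - b) by lra.
  rewrite normrM ler_wpM2r // ler_norml.
  by move: aM bM; rewrite !ler_norml => /andP[? ?] /andP[? ?]; lra.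
have neg_lip a b : `|a| <= M -> `|b| <= M ->
    `|half_sq_neg a - half_sq_neg b| <= M * `|a - b|.
  have pospart_le (c : R) : `|c| <= M -> `|pospart (- c)| <= M.
    by rewrite !ler_norml => /andP[? ?]; case: pospartP; lra.
  move=> /pospart_le aM /pospart_le bM; apply: le_trans (sq_lip _ _ aM bM) _.
  by rewrite ler_wpM2l // (le_trans (pospart_lipschitz _ _)) // opprK addrC distrC.
rewrite /piece opprD addrACA (le_trans (ler_normD _ _)) //.
rewrite [leRHS](_ : _ = M * `|y - z| + M * `|y - z|); last by lra.
by apply: lerD; [apply: le_trans (sq_lip _ _ _ _) _ |
  apply: le_trans (neg_lip _ _ _ _) _]; rewrite ?ler_wpM2l.
Qed.

(** * The function psi as a minimum *)

(** Since [a ^+ 2 = pospart a ^+ 2 + pospart (- a) ^+ 2], the difference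
    [piece i j x - piece j i x] is half of
    [pospart (x 0 i) ^+ 2 - pospart (x 0 j) ^+ 2], and the positive part is
    nondecreasing. *)
Lemma piece_le (R : realType) (i j : 'I_2) (x : 'rV[R]_2) :
  x 0 i <= x 0 j -> piece i j x <= piece j i x.
Proof.
rewrite /piece /half_sq_neg => xij.
case: (pospartP (- x 0 i)) => Hi; case: (pospartP (- x 0 j)) => Hj; nra.
Qed.

Lemma psi_min (R : realType) (x : 'rV[R]_2) :
  psi x = Num.min (piece 0 1 x) (piece 1 0 x).
Proof.
rewrite /psi; case: leP => x01; first by rewrite min_l // piece_le.
by rewrite min_r // piece_le // ltW.
Qed.

Lemma psi_le_piece01 (R : realType) (x : 'rV[R]_2) : psi x <= piece 0 1 x.
Proof. by rewrite psi_min ge_min lexx. Qed.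

Lemma psi_le_piece10 (R : realType) (x : 'rV[R]_2) : psi x <= piece 1 0 x.
Proof. by rewrite psi_min ge_min lexx orbT. Qed.

Lemma psi_piece01 (R : realType) (x : 'rV[R]_2) :
  x 0 0 <= x 0 1 -> psi x = piece 0 1 x.
Proof. by move=> x01; rewrite psi_min min_l // piece_le. Qed.

Lemma psi_piece10 (R : realType) (x : 'rV[R]_2) :
  x 0 1 <= x 0 0 -> psi x = piece 1 0 x.
Proof. by move=> x10; rewrite psi_min min_r // piece_le. Qed.

Lemma psi_active_piece (R : realType) (x : 'rV[R]_2) :
  psi x = piece 0 1 x \/ psi x = piece 1 0 x.
Proof. by rewrite psi_min; case: leP; [left | right]. Qed.

(** This is where the representation as a minimum pays: wherever [psi] is
    differentiable, its gradient is that of any piece equal to it there, even on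
    the diagonal and without knowing which piece is active nearby. *)
Lemma touching_piece_gradient (R : realType) (i j : 'I_2) (F : 'rV[R]_2 -> R)
    (x : 'rV[R]_2) :
  (forall y, F y <= piece i j y) -> F x = piece i j x ->
  differentiable F x -> gradient F x = piece_gradient i j x.
Proof.
move=> Fle Fx dF; apply: upper_tangent_gradient => // y.
have /andP[_] := piece_tangent i j x y.
by move: (Fle y); rewrite Fx; lra.
Qed.

Lemma gradient_psi01 (R : realType) (x : 'rV[R]_2) :
  x 0 0 <= x 0 1 -> differentiable (@psi R) x ->
  gradient (@psi R) x = piece_gradient 0 1 x.
Proof.
move=> x01; apply: touching_piece_gradient; first exact: psi_le_piece01.
exact: psi_piece01.
Qed.

Lemma gradient_psi10 (R : realType) (x : 'rV[R]_2) :
  x 0 1 <= x 0 0 -> differentiable (@psi R) x ->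
  gradient (@psi R) x = piece_gradient 1 0 x.
Proof.
move=> x10; apply: touching_piece_gradient; first exact: psi_le_piece10.
exact: psi_piece10.
Qed.

(** [F] may switch between the pieces near [x], as [psi] does on the diagonal,
    provided that they agree at [x] to first order. *)
Lemma differentiable_selection (R : realType) (F : 'rV[R]_2 -> R)
    (x g : 'rV[R]_2) :
  (\forall y \near x, exists i j, [/\ F y = piece i j y, F x = piece i j x
     & piece_gradient i j x = g]) ->
  differentiable F x.
Proof.
move=> sel; apply: (@quadratic_differentiable _ _ _ _ g).
apply: filterS sel => y [i [j [-> -> <-]]].
by have /andP[lo hi] := piece_tangent i j x y; rewrite ger0_norm.
Qed.

Lemma psi_differentiable (R : realType) (x : 'rV[R]_2) :
  (@K1 R `|` @K2 R) x -> differentiable (@psi R) x.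
Proof.
have lt01 : x 0 0 < x 0 1 -> differentiable (@psi R) x.
  move=> x01; apply: (@differentiable_selection _ _ _ (piece_gradient 0 1 x)).
  apply: filterS (near_entry_lt x01) => y y01; exists 0, 1.
  by rewrite !psi_piece01 // ltW.
have lt10 : x 0 1 < x 0 0 -> differentiable (@psi R) x.
  move=> x10; apply: (@differentiable_selection _ _ _ (piece_gradient 1 0 x)).
  apply: filterS (near_entry_lt x10) => y y10; exists 1, 0.
  by rewrite !psi_piece10 // ltW.
have diag : x 0 0 = x 0 1 /\ x 0 1 <= 0 -> differentiable (@psi R) x.
  move=> [xeq x1].
  apply: (@differentiable_selection _ _ _ (piece_gradient 0 1 x)).
  have grad_eq : piece_gradient 1 0 x = piece_gradient 0 1 x.
    rewrite /piece_gradient -!scaleNr !pospartN_opp ?xeq //.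
    by rewrite addrC.
  apply: (@filterE _ (nbhs x)) => y; have [yE | yE] := psi_active_piece y.
    by exists 0, 1; split => //; rewrite psi_piece01 // xeq.
  by exists 1, 0; split => //; rewrite psi_piece10 // xeq.
by case=> -[].
Qed.

(** For [z] fixed, bounding [psi y] by the piece active at [z] reduces the
    Lipschitz estimate of the minimum to that of one piece. *)
Lemma psi_locally_lipschitz (R : realType) : locally_lipschitz (@psi R).
Proof.
move=> x; exists (ball x 1); first exact: nbhsx_ballx.
pose M := `|x| + 1.
have ballM y : ball x 1 y -> `|y| <= M.
  rewrite -ball_normE /= => /ltW xy.
  by rewrite -(subKr x y) (le_trans (ler_normB _ _)) // lerD2l.
have half y z : `|y| <= M -> `|z| <= M -> psi y - psi z <= 2 * M * `|y - z|.
  move=> yM zM.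
  have bound i j : piece i j y - piece i j z <= 2 * M * `|y - z|.
    exact: le_trans (ler_norm _) (piece_lipschitz_on_ball i j yM zM).
  case: (psi_active_piece z) => ->.
    by apply: le_trans (bound 0 1); rewrite lerD2r psi_le_piece01.
  by apply: le_trans (bound 1 0); rewrite lerD2r psi_le_piece10.
apply: (@klipschitzW _ _ _ (2 * M)).
  by apply: (@globally_properfilter _ _ (x, x)); split; exact: ballxx.
move=> [y z] [/= /ballM yM /ballM zM].
rewrite ler_norml half // andbT lerNl opprB distrC; exact: half.
Qed.

Lemma vec2_0 (R : realType) (s t : R) : vec2 s t 0 0 = s.
Proof. by rewrite mxE. Qed.

Lemma vec2_1 (R : realType) (s t : R) : vec2 s t 0 1 = t.
Proof. by rewrite mxE. Qed.

Lemma piece_gradient01 (R : realType) (s t : R) :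
  piece_gradient 0 1 (vec2 s t) = vec2 s (- pospart (- t)).
Proof.
apply/rowP => k; rewrite /piece_gradient vec2_0 vec2_1 !mxE.
by case: k => [[|[|k]] kP] //=; rewrite ?mulr1 ?mulr0 ?subr0 ?add0r.
Qed.

Lemma piece_gradient10 (R : realType) (s t : R) :
  piece_gradient 1 0 (vec2 s t) = vec2 (- pospart (- s)) t.
Proof.
apply/rowP => k; rewrite /piece_gradient vec2_0 vec2_1 !mxE.
by case: k => [[|[|k]] kP] //=; rewrite ?mulr1 ?mulr0 ?subr0 ?add0r.
Qed.

(** * The B-subdifferential of psi *)

Lemma cvg_harmonic_shift (R : realType) (d : nat) (x v : 'rV[R]_d) :
  x + harmonic k *: v @[k --> \oo] --> x.
Proof.
rewrite -[X in _ --> X]addr0 -(scale0r v).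
exact: cvgD (cvg_cst _) (cvgZ cvg_harmonic (cvg_cst _)).
Qed.

(** Moving [x] away from the diagonal into the half-plane where [piece 0 1] is
    active gives differentiability points at which the gradient is known; this
    covers the points of the diagonal as well. *)
Lemma B_subdifferential_psi01 (R : realType) (x : 'rV[R]_2) :
  x 0 0 <= x 0 1 -> B_subdifferential (@psi R) x (piece_gradient 0 1 x).
Proof.
move=> x01; pose u k := x + @harmonic R k *: delta_mx 0 1.
have u01 k : u k 0 0 < u k 0 1.
  by rewrite !mxE /= mulr0 addr0 mulr1 (le_lt_trans x01) // ltrDl harmonic_gt0.
have du k : differentiable (@psi R) (u k).
  by apply: psi_differentiable; right; left.
apply: (@B_subdifferential_approx _ _ _ _ _ u) => //.
- exact: piece_gradient_continuous.
- exact: cvg_harmonic_shift.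
- by move=> k; apply: gradient_psi01 => //; exact: ltW.
Qed.

Lemma B_subdifferential_psi10 (R : realType) (x : 'rV[R]_2) :
  x 0 1 <= x 0 0 -> B_subdifferential (@psi R) x (piece_gradient 1 0 x).
Proof.
move=> x10; pose u k := x + @harmonic R k *: delta_mx 0 0.
have u10 k : u k 0 1 < u k 0 0.
  by rewrite !mxE /= mulr0 addr0 mulr1 (le_lt_trans x10) // ltrDl harmonic_gt0.
have du k : differentiable (@psi R) (u k).
  by apply: psi_differentiable; left; left.
apply: (@B_subdifferential_approx _ _ _ _ _ u) => //.
- exact: piece_gradient_continuous.
- exact: cvg_harmonic_shift.
- by move=> k; apply: gradient_psi10 => //; exact: ltW.
Qed.

Lemma B_subdifferential_psi_branch (R : realType) (x g : 'rV[R]_2) :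
  B_subdifferential (@psi R) x g ->
  g = piece_gradient 0 1 x \/ g = piece_gradient 1 0 x.
Proof.
apply: B_subdifferential_branch; try exact: piece_gradient_continuous.
apply: (@filterE _ (nbhs x)) => y dy; case: (leP (y 0 0) (y 0 1)) => y01.
  by left; exact: gradient_psi01.
by right; apply: gradient_psi10 => //; exact: ltW.
Qed.

Lemma B_subdifferential_psi_lt01 (R : realType) (x g : 'rV[R]_2) :
  x 0 0 < x 0 1 -> B_subdifferential (@psi R) x g -> g = piece_gradient 0 1 x.
Proof.
move=> x01 Bg.
suff [] : g = piece_gradient 0 1 x \/ g = piece_gradient 0 1 x by [].
apply: B_subdifferential_branch Bg; try exact: piece_gradient_continuous.
apply: filterS (near_entry_lt x01) => y y01 dy.
by left; apply: gradient_psi01 => //; exact: ltW.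
Qed.

Lemma B_subdifferential_psi_lt10 (R : realType) (x g : 'rV[R]_2) :
  x 0 1 < x 0 0 -> B_subdifferential (@psi R) x g -> g = piece_gradient 1 0 x.
Proof.
move=> x10 Bg.
suff [] : g = piece_gradient 1 0 x \/ g = piece_gradient 1 0 x by [].
apply: B_subdifferential_branch Bg; try exact: piece_gradient_continuous.
apply: filterS (near_entry_lt x10) => y y10 dy.
by left; apply: gradient_psi10 => //; exact: ltW.
Qed.

(** * Sign, complementarity and closed formula *)

Lemma psi_ge0 (R : realType) (x : 'rV[R]_2) : 0 <= psi x.
Proof.
rewrite psi_min le_min /piece /half_sq_neg.
by rewrite !addr_ge0 // divr_ge0 // sqr_ge0.
Qed.

Lemma psi_C_function (R : realType) : C_function (@psi R).
Proof.
move=> s t; rewrite /psi vec2_0 vec2_1.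
have sqsum0 (a b : R) : a ^+ 2 / 2 + b ^+ 2 / 2 = 0 -> a = 0 /\ b = 0.
  move=> ab; have := sqr_ge0 a; have := sqr_ge0 b => b2 a2.
  by split; apply/eqP; rewrite -sqrf_eq0; apply/eqP; lra.
case: leP => st.
  split=> [/sqsum0[s0 t0] | [s0 t0 /eqP]].
    by rewrite s0 mul0r; case: (pospartP (- t)) t0 => *; split=> //; lra.
  rewrite mulf_eq0 => st0.
  have -> : s = 0 by case/orP: st0 => /eqP ?; lra.
  have -> : pospart (- t) = 0 by case: pospartP => ?; lra.
  lra.
split=> [/sqsum0[t0 s0] | [s0 t0 /eqP]].
  by rewrite t0 mulr0; case: (pospartP (- s)) s0 => *; split=> //; lra.
rewrite mulf_eq0 => st0.
have -> : t = 0 by case/orP: st0 => /eqP ?; lra.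
have -> : pospart (- s) = 0 by case: pospartP => ?; lra.
lra.
Qed.

Lemma psi_min_max (R : realType) (s t : R) :
  psi (vec2 s t) = Num.min s t ^+ 2 / 2 + Num.max (- Num.max s t) 0 ^+ 2 / 2.
Proof.
by rewrite /psi vec2_0 vec2_1 /pospart [Num.max _ 0]maxC; case: leP.
Qed.

Theorem proposition3p9 (R : realType) :
  (forall s t : R,
     psi (vec2 s t) = Num.min s t ^+ 2 / 2 + Num.max (- Num.max s t) 0 ^+ 2 / 2)
  /\ (forall x : 'rV[R]_2, 0 <= psi x)
  /\ C_function (@psi R)
  /\ (forall x : 'rV[R]_2, (@K1 R `|` @K2 R) x -> differentiable (@psi R) x)
  /\ locally_lipschitz (@psi R)
  /\ (forall s t : R,
        (s < t \/ (s = t /\ t <= 0) ->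
           B_subdifferential (@psi R) (vec2 s t)
             = [set vec2 s (- pospart (- t))])
     /\ (s > t ->
           B_subdifferential (@psi R) (vec2 s t)
             = [set vec2 (- pospart (- s)) t])
     /\ (s = t /\ t > 0 ->
           B_subdifferential (@psi R) (vec2 s t)
             = [set vec2 s 0; vec2 0 t])).
Proof.
split; first exact: psi_min_max.
split; first exact: psi_ge0.
split; first exact: psi_C_function.
split; first exact: psi_differentiable.
split; first exact: psi_locally_lipschitz.
move=> s t.
have := @B_subdifferential_psi01 R (vec2 s t).
have := @B_subdifferential_psi10 R (vec2 s t).
have := @B_subdifferential_psi_branch R (vec2 s t).
have := @B_subdifferential_psi_lt01 R (vec2 s t).
have := @B_subdifferential_psi_lt10 R (vec2 s t).
rewrite vec2_0 vec2_1 piece_gradient01 piece_gradient10.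
move=> lt10 lt01 branch mem10 mem01.
split; [move=> st | split=> [ts | [st t0]]]; apply/seteqP; split=> g /=.
- case: st => [|[st t0]]; first exact: lt01.
  by move: branch; rewrite st !pospartN_opp // => branch /branch[].
- by move=> ->; apply: mem01; case: st => [/ltW // | [-> _]]; exact: lexx.
- exact: lt10.
- by move=> ->; apply: mem10; exact: ltW.
- by move: branch; rewrite st pospartN0 // oppr0 => branch /branch.
- move: mem01 mem10; rewrite st pospartN0 // oppr0 => mem01 mem10.
  by case=> ->; [exact: mem01 | exact: mem10].
Qed.
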